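(* Consider the Poisson manifold $(\mathbb R^2,\Pi=(x^2+y^2)\,\partial_x\wedge\partial_y)$. Denote $$\partial_\theta:=x\partial_y-y\partial_x,\qquad D_r:=r\partial_r=x\partial_x+y\partial_y,\qquad \mathrm{Vol}:=\partial_x\wedge\partial_y$$ (so that $\partial_\theta\wedge D_r=-r^2\,\mathrm{Vol}=-\Pi$, where $r^2=x^2+y^2$). Then the Poisson cohomology is given by $$H^0(\mathbb R^2,\Pi)=\mathbb R,\qquad H^1(\mathbb R^2,\Pi)=\mathbb R\,\partial_\theta\oplus\mathbb R\,D_r,\qquad H^2(\mathbb R^2,\Pi)=\mathbb R\,\mathrm{Vol}\oplus\mathbb R\,\Pi,$$ i.e. the constant function $1$, respectively the classes of $\partial_\theta,D_r$, respectively the classes of $\mathrm{Vol},\Pi$, form a basis of $H^0$, $H^1$, $H^2$.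
   Context: The Poisson cohomology $H^\bullet(M,\Pi)$ of a Poisson manifold $M$ with bivector $\Pi$ is the cohomology of the complex of smooth multivector fields $\mathfrak X^\bullet(M)=\Lambda^\bullet_{C^\infty(M)}\mathfrak X(M)$ with differential $\partial_\Pi=[\Pi,-]$, where $[-,-]$ is the Schouten--Nijenhuis bracket: the unique bracket of degree $-1$ on $\mathfrak X^\bullet(M)$ which is a super Lie bracket on the shift by one, satisfies $[a,b\wedge c]=[a,b]\wedge c+(-1)^{(|a|-1)|b|}b\wedge[a,c]$, extends the Lie bracket of vector fields, and satisfies $[X,f]=X(f)$ for vector fields $X$ and functions $f$. *)

(* Defs.v *)
From Stdlib Require Import Reals Lra Lia ZArith List Setoid Ring.
From Stdlib Require Import FunctionalExtensionality PropExtensionality ProofIrrelevance.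
From Coquelicot Require Import Coquelicot.
Import ListNotations.
Open Scope R_scope.

(** * Smooth functions on the plane *)

(** [ex_diff_n f n x y] is Coquelicot's predicate "[f] is of class C^n": all
    partial derivatives of order [<= n], in any order of the variables, exist
    and are continuous. *)
Definition smooth (f : R -> R -> R) : Prop := forall n x y, ex_diff_n f n x y.

Record Cinf := mkCinf { cfun :> R -> R -> R; cfun_smooth : smooth cfun }.

Lemma Cinf_ext (f g : Cinf) : (forall x y, f x y = g x y) -> f = g.
Proof.
  destruct f as [f hf], g as [g hg]; simpl; intros h.
  assert (e : f = g).
  { apply functional_extensionality; intros x.
    apply functional_extensionality; intros y; apply h. }
  subst g; f_equal; apply proof_irrelevance.
Qed.

Definition Dx (f : R -> R -> R) : R -> R -> R := fun x y => Derive (fun t => f t y) x.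
Definition Dy (f : R -> R -> R) : R -> R -> R := fun x y => Derive (fun t => f x t) y.

Lemma ex_diff_n_ext f g n :
  (forall x y, f x y = g x y) ->
  (forall x y, ex_diff_n f n x y) -> forall x y, ex_diff_n g n x y.
Proof.
  intros h hf x y; apply (ex_diff_n_ext_loc f); [|apply hf].
  exists (mkposreal 1 Rlt_0_1); intros; apply h.
Qed.

Lemma ex_diff_n_S f n :
  (forall x y, continuity_2d_pt f x y) ->
  (forall x y, ex_derive (fun z => f z y) x) ->
  (forall x y, ex_derive (fun z => f x z) y) ->
  (forall x y, ex_diff_n (Dx f) n x y) -> (forall x y, ex_diff_n (Dy f) n x y) ->
  forall x y, ex_diff_n f (S n) x y.
Proof. intros c dx dy hx hy x y; simpl; repeat split; auto. Qed.

Lemma ex_diff_n_cont f n x y : ex_diff_n f n x y -> continuity_2d_pt f x y.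
Proof. destruct n; simpl; tauto. Qed.

Lemma smooth_cont f x y : smooth f -> continuity_2d_pt f x y.
Proof. intros h; apply (h 0%nat). Qed.

Lemma smooth_ex_dx f x y : smooth f -> ex_derive (fun z => f z y) x.
Proof. intros h; apply (h 1%nat x y). Qed.

Lemma smooth_ex_dy f x y : smooth f -> ex_derive (fun z => f x z) y.
Proof. intros h; apply (h 1%nat x y). Qed.

Lemma smooth_Dx f : smooth f -> smooth (Dx f).
Proof. intros h n x y; apply (h (S n) x y). Qed.

Lemma smooth_Dy f : smooth f -> smooth (Dy f).
Proof. intros h n x y; apply (h (S n) x y). Qed.

Lemma smooth_cst c : smooth (fun _ _ => c).
Proof.
  intros n; revert c; induction n as [|n IH]; intros c.
  - intros x y; split; [apply continuity_2d_pt_const | exact I].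
  - apply ex_diff_n_S.
    + intros; apply continuity_2d_pt_const.
    + intros; apply ex_derive_const.
    + intros; apply ex_derive_const.
    + apply ex_diff_n_ext with (2 := IH 0).
      intros; unfold Dx; symmetry; apply Derive_const.
    + apply ex_diff_n_ext with (2 := IH 0).
      intros; unfold Dy; symmetry; apply Derive_const.
Qed.

Lemma smooth_fst : smooth (fun x _ => x).
Proof.
  intros [|n].
  - intros x y; split; [apply continuity_2d_pt_id1 | exact I].
  - apply ex_diff_n_S.
    + intros; apply continuity_2d_pt_id1.
    + intros; apply ex_derive_id.
    + intros; apply ex_derive_const.
    + apply ex_diff_n_ext with (2 := smooth_cst 1 n).
      intros; unfold Dx; symmetry; apply Derive_id.
    + apply ex_diff_n_ext with (2 := smooth_cst 0 n).
      intros; unfold Dy; symmetry; apply Derive_const.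
Qed.

Lemma smooth_snd : smooth (fun _ y => y).
Proof.
  intros [|n].
  - intros x y; split; [apply continuity_2d_pt_id2 | exact I].
  - apply ex_diff_n_S.
    + intros; apply continuity_2d_pt_id2.
    + intros; apply ex_derive_const.
    + intros; apply ex_derive_id.
    + apply ex_diff_n_ext with (2 := smooth_cst 0 n).
      intros; unfold Dx; symmetry; apply Derive_const.
    + apply ex_diff_n_ext with (2 := smooth_cst 1 n).
      intros; unfold Dy; symmetry; apply Derive_id.
Qed.

Lemma ex_diff_n_plus n : forall f g,
  (forall x y, ex_diff_n f n x y) -> (forall x y, ex_diff_n g n x y) ->
  forall x y, ex_diff_n (fun x y => f x y + g x y) n x y.
Proof.
  induction n as [|n IH]; intros f g hf hg.
  - intros x y; split; [|exact I].
    apply continuity_2d_pt_plus; [apply (hf x y) | apply (hg x y)].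
  - apply ex_diff_n_S.
    + intros x y; apply continuity_2d_pt_plus; [apply (hf x y) | apply (hg x y)].
    + intros x y; apply (ex_derive_plus (fun z => f z y) (fun z => g z y));
        [apply (hf x y) | apply (hg x y)].
    + intros x y; apply (ex_derive_plus (fun z => f x z) (fun z => g x z));
        [apply (hf x y) | apply (hg x y)].
    + apply ex_diff_n_ext with (f := fun x y => Dx f x y + Dx g x y).
      * intros x y; unfold Dx; symmetry; apply Derive_plus; [apply (hf x y) | apply (hg x y)].
      * apply IH; intros x y; [apply (hf x y) | apply (hg x y)].
    + apply ex_diff_n_ext with (f := fun x y => Dy f x y + Dy g x y).
      * intros x y; unfold Dy; symmetry; apply Derive_plus; [apply (hf x y) | apply (hg x y)].
      * apply IH; intros x y; [apply (hf x y) | apply (hg x y)].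
Qed.

Lemma ex_diff_n_mult n : forall f g,
  (forall x y, ex_diff_n f n x y) -> (forall x y, ex_diff_n g n x y) ->
  forall x y, ex_diff_n (fun x y => f x y * g x y) n x y.
Proof.
  induction n as [|n IH]; intros f g hf hg.
  - intros x y; split; [|exact I].
    apply continuity_2d_pt_mult; [apply (hf x y) | apply (hg x y)].
  - assert (hf' : forall x y, ex_diff_n f n x y)
      by (intros x y; apply (ex_diff_n_m (S n)); [lia | apply hf]).
    assert (hg' : forall x y, ex_diff_n g n x y)
      by (intros x y; apply (ex_diff_n_m (S n)); [lia | apply hg]).
    apply ex_diff_n_S.
    + intros x y; apply continuity_2d_pt_mult; [apply (hf x y) | apply (hg x y)].
    + intros x y; apply (ex_derive_mult (fun z => f z y) (fun z => g z y));
        [apply (hf x y) | apply (hg x y)].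
    + intros x y; apply (ex_derive_mult (fun z => f x z) (fun z => g x z));
        [apply (hf x y) | apply (hg x y)].
    + apply ex_diff_n_ext with (f := fun x y => Dx f x y * g x y + f x y * Dx g x y).
      * intros x y; unfold Dx; symmetry.
        apply (Derive_mult (fun z => f z y) (fun z => g z y)); [apply (hf x y) | apply (hg x y)].
      * apply (ex_diff_n_plus n (fun x y => Dx f x y * g x y) (fun x y => f x y * Dx g x y));
          apply IH; auto; intros x y; [apply (hf x y) | apply (hg x y)].
    + apply ex_diff_n_ext with (f := fun x y => Dy f x y * g x y + f x y * Dy g x y).
      * intros x y; unfold Dy; symmetry.
        apply (Derive_mult (fun z => f x z) (fun z => g x z)); [apply (hf x y) | apply (hg x y)].
      * apply (ex_diff_n_plus n (fun x y => Dy f x y * g x y) (fun x y => f x y * Dy g x y));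
          apply IH; auto; intros x y; [apply (hf x y) | apply (hg x y)].
Qed.

Lemma smooth_plus f g : smooth f -> smooth g -> smooth (fun x y => f x y + g x y).
Proof. intros hf hg n; apply ex_diff_n_plus; [apply hf | apply hg]. Qed.

Lemma smooth_mult f g : smooth f -> smooth g -> smooth (fun x y => f x y * g x y).
Proof. intros hf hg n; apply ex_diff_n_mult; [apply hf | apply hg]. Qed.

Definition ccst (c : R) : Cinf := mkCinf _ (smooth_cst c).
Definition cx : Cinf := mkCinf _ smooth_fst.
Definition cy : Cinf := mkCinf _ smooth_snd.
Definition cadd (f g : Cinf) : Cinf :=
  mkCinf _ (smooth_plus _ _ (cfun_smooth f) (cfun_smooth g)).
Definition cmul (f g : Cinf) : Cinf :=
  mkCinf _ (smooth_mult _ _ (cfun_smooth f) (cfun_smooth g)).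
Definition copp (f : Cinf) : Cinf := cmul (ccst (-1)) f.
Definition csub (f g : Cinf) : Cinf := cadd f (copp g).
Definition cdx (f : Cinf) : Cinf := mkCinf _ (smooth_Dx _ (cfun_smooth f)).
Definition cdy (f : Cinf) : Cinf := mkCinf _ (smooth_Dy _ (cfun_smooth f)).

Declare Scope Cinf_scope.
Delimit Scope Cinf_scope with Ci.
Bind Scope Cinf_scope with Cinf.
Notation "0" := (ccst 0) : Cinf_scope.
Notation "1" := (ccst 1) : Cinf_scope.
Infix "+" := cadd : Cinf_scope.
Infix "*" := cmul : Cinf_scope.
Infix "-" := csub : Cinf_scope.
Notation "- f" := (copp f) : Cinf_scope.

Lemma Cinf_ring_theory : ring_theory 0%Ci 1%Ci cadd cmul csub copp (@eq Cinf).
Proof. constructor; intros; apply Cinf_ext; intros; simpl; ring. Qed.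

Add Ring Cinf_ring : Cinf_ring_theory.

Lemma ccst_add a b : ccst (a + b) = (ccst a + ccst b)%Ci.
Proof. apply Cinf_ext; intros; reflexivity. Qed.
Lemma ccst_mul a b : ccst (a * b) = (ccst a * ccst b)%Ci.
Proof. apply Cinf_ext; intros; reflexivity. Qed.

Lemma ccst_m1 : ccst (-1) = (- (1))%Ci.
Proof. apply Cinf_ext; intros; simpl; ring. Qed.

Lemma cdx_cst c : cdx (ccst c) = 0%Ci.
Proof. apply Cinf_ext; intros x y; exact (Derive_const c x). Qed.
Lemma cdy_cst c : cdy (ccst c) = 0%Ci.
Proof. apply Cinf_ext; intros x y; exact (Derive_const c y). Qed.
Lemma cdx_x : cdx cx = 1%Ci.
Proof. apply Cinf_ext; intros x y; exact (Derive_id x). Qed.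
Lemma cdy_x : cdy cx = 0%Ci.
Proof. apply Cinf_ext; intros x y; exact (Derive_const x y). Qed.
Lemma cdx_y : cdx cy = 0%Ci.
Proof. apply Cinf_ext; intros x y; exact (Derive_const y x). Qed.
Lemma cdy_y : cdy cy = 1%Ci.
Proof. apply Cinf_ext; intros x y; exact (Derive_id y). Qed.

Lemma cdx_add f g : cdx (f + g)%Ci = (cdx f + cdx g)%Ci.
Proof.
  apply Cinf_ext; intros x y; apply (Derive_plus (fun z => f z y) (fun z => g z y));
    apply smooth_ex_dx, cfun_smooth.
Qed.
Lemma cdy_add f g : cdy (f + g)%Ci = (cdy f + cdy g)%Ci.
Proof.
  apply Cinf_ext; intros x y; apply (Derive_plus (fun z => f x z) (fun z => g x z));
    apply smooth_ex_dy, cfun_smooth.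
Qed.
Lemma cdx_mul f g : cdx (f * g)%Ci = (cdx f * g + f * cdx g)%Ci.
Proof.
  apply Cinf_ext; intros x y; apply (Derive_mult (fun z => f z y) (fun z => g z y));
    apply smooth_ex_dx, cfun_smooth.
Qed.
Lemma cdy_mul f g : cdy (f * g)%Ci = (cdy f * g + f * cdy g)%Ci.
Proof.
  apply Cinf_ext; intros x y; apply (Derive_mult (fun z => f x z) (fun z => g x z));
    apply smooth_ex_dy, cfun_smooth.
Qed.
Lemma cdx_opp f : cdx (- f)%Ci = (- cdx f)%Ci.
Proof. unfold copp at 1; rewrite cdx_mul, cdx_cst; unfold copp; ring. Qed.
Lemma cdy_opp f : cdy (- f)%Ci = (- cdy f)%Ci.
Proof. unfold copp at 1; rewrite cdy_mul, cdy_cst; unfold copp; ring. Qed.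
Lemma cdx_sub f g : cdx (f - g)%Ci = (cdx f - cdx g)%Ci.
Proof. unfold csub; now rewrite cdx_add, cdx_opp. Qed.
Lemma cdy_sub f g : cdy (f - g)%Ci = (cdy f - cdy g)%Ci.
Proof. unfold csub; now rewrite cdy_add, cdy_opp. Qed.

Lemma cdx_dy f : cdx (cdy f) = cdy (cdx f).
Proof.
  apply Cinf_ext; intros x y; symmetry; simpl; unfold Dx, Dy.
  pose proof (cfun_smooth f) as h; symmetry; apply (Schwarz f x y).
  - exists (mkposreal 1 Rlt_0_1); intros u v _ _; repeat split.
    + now apply smooth_ex_dx.
    + now apply smooth_ex_dy.
    + apply (smooth_ex_dx (Dy f)), smooth_Dy, h.
    + apply (smooth_ex_dy (Dx f)), smooth_Dx, h.
  - apply (smooth_cont (Dx (Dy f))), smooth_Dx, smooth_Dy, h.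
  - apply (smooth_cont (Dy (Dx f))), smooth_Dy, smooth_Dx, h.
Qed.

Ltac cder := repeat first
  [ rewrite cdx_cst | rewrite cdy_cst | rewrite cdx_x | rewrite cdy_x
  | rewrite cdx_y | rewrite cdy_y | rewrite cdx_add | rewrite cdy_add
  | rewrite cdx_mul | rewrite cdy_mul | rewrite cdx_opp | rewrite cdy_opp
  | rewrite cdx_sub | rewrite cdy_sub | rewrite cdx_dy ].

(** * Multivector fields on the plane *)

(** The exterior algebra of the vector fields on the plane over the smooth
    functions: the free module on [1], [d/dx], [d/dy] and [d/dx ^ d/dy].  The
    grading is by all of [Z]; see [homog]. *)
Record mvf := Mvf { mv0 : Cinf; mvx : Cinf; mvy : Cinf; mvxy : Cinf }.

Definition mv_plus (a b : mvf) : mvf :=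
  Mvf (mv0 a + mv0 b) (mvx a + mvx b) (mvy a + mvy b) (mvxy a + mvxy b).
Definition mv_opp (a : mvf) : mvf :=
  Mvf (- mv0 a) (- mvx a) (- mvy a) (- mvxy a).
Definition mv_zero : mvf := Mvf 0 0 0 0.
Definition mv_scal (c : R) (a : mvf) : mvf :=
  Mvf (ccst c * mv0 a) (ccst c * mvx a) (ccst c * mvy a) (ccst c * mvxy a).

Lemma mvf_ext (a b : mvf) :
  mv0 a = mv0 b -> mvx a = mvx b -> mvy a = mvy b -> mvxy a = mvxy b -> a = b.
Proof. destruct a, b; simpl; congruence. Qed.

Definition mvf_AbelianMonoid_mixin : AbelianMonoid.mixin_of mvf.
Proof.
  refine (AbelianMonoid.Mixin mvf mv_plus mv_zero _ _ _);
    intros; apply mvf_ext; simpl; ring.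
Defined.
Canonical mvf_AbelianMonoid := AbelianMonoid.Pack mvf mvf_AbelianMonoid_mixin mvf.

Definition mvf_AbelianGroup_mixin : AbelianGroup.mixin_of mvf_AbelianMonoid.
Proof.
  refine (AbelianGroup.Mixin mvf_AbelianMonoid mv_opp _).
  intros; apply mvf_ext; simpl; ring.
Defined.
Canonical mvf_AbelianGroup :=
  AbelianGroup.Pack mvf (AbelianGroup.Class _ _ mvf_AbelianGroup_mixin) mvf.

Definition mvf_ModuleSpace_mixin : ModuleSpace.mixin_of R_Ring mvf_AbelianGroup.
Proof.
  refine (ModuleSpace.Mixin R_Ring mvf_AbelianGroup mv_scal _ _ _ _);
    intros; unfold mult, plus, one; simpl; apply mvf_ext; simpl;
    try rewrite ccst_mul; try rewrite ccst_add; ring.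
Defined.
Canonical mvf_ModuleSpace :=
  ModuleSpace.Pack R_Ring mvf (ModuleSpace.Class _ _ _ mvf_ModuleSpace_mixin) mvf.

Definition homog (k : Z) (a : mvf) : Prop :=
  (k <> 0%Z -> mv0 a = 0%Ci) /\
  (k <> 1%Z -> mvx a = 0%Ci /\ mvy a = 0%Ci) /\
  (k <> 2%Z -> mvxy a = 0%Ci).

Definition fn (f : Cinf) : mvf := Mvf f 0 0 0.
Definition ddx : mvf := Mvf 0 1 0 0.
Definition ddy : mvf := Mvf 0 0 1 0.

Definition wedge (a b : mvf) : mvf :=
  Mvf (mv0 a * mv0 b)
      (mv0 a * mvx b + mvx a * mv0 b)
      (mv0 a * mvy b + mvy a * mv0 b)
      (mv0 a * mvxy b + mvx a * mvy b - mvy a * mvx b + mvxy a * mv0 b).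

Declare Scope mvf_scope.
Delimit Scope mvf_scope with mv.
Bind Scope mvf_scope with mvf.
Infix "∧" := wedge (at level 40, left associativity) : mvf_scope.

(** [mvf_decomp], [wedge_ddx_ddx], ... together with associativity and the sign
    rule determine [wedge] as the product of the exterior algebra. *)
Lemma mvf_decomp (a : mvf) :
  a = plus (fn (mv0 a)) (plus (fn (mvx a) ∧ ddx)
        (plus (fn (mvy a) ∧ ddy) (fn (mvxy a) ∧ (ddx ∧ ddy))))%mv.
Proof. apply mvf_ext; simpl; ring. Qed.

Lemma wedgeA a b c : (a ∧ (b ∧ c) = a ∧ b ∧ c)%mv.
Proof. apply mvf_ext; simpl; ring. Qed.
Lemma wedge1l a : (fn 1 ∧ a = a)%mv.
Proof. apply mvf_ext; simpl; ring. Qed.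
Lemma wedge1r a : (a ∧ fn 1 = a)%mv.
Proof. apply mvf_ext; simpl; ring. Qed.
Lemma wedge_plus_l a b c : (plus a b ∧ c = plus (a ∧ c) (b ∧ c))%mv.
Proof. apply mvf_ext; simpl; ring. Qed.
Lemma wedge_plus_r a b c : (c ∧ plus a b = plus (c ∧ a) (c ∧ b))%mv.
Proof. apply mvf_ext; simpl; ring. Qed.
Lemma wedge_fn_fn f g : (fn f ∧ fn g)%mv = fn (f * g).
Proof. apply mvf_ext; simpl; ring. Qed.
Lemma wedge_fn_comm f a : (fn f ∧ a = a ∧ fn f)%mv.
Proof. apply mvf_ext; simpl; ring. Qed.
Lemma wedge_ddx_ddx : (ddx ∧ ddx)%mv = zero.
Proof. apply mvf_ext; simpl; ring. Qed.
Lemma wedge_ddy_ddy : (ddy ∧ ddy)%mv = zero.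
Proof. apply mvf_ext; simpl; ring. Qed.
Lemma wedge_ddy_ddx : (ddy ∧ ddx)%mv = opp (ddx ∧ ddy)%mv.
Proof. apply mvf_ext; simpl; ring. Qed.
Lemma scal_wedge c a : scal c a = (fn (ccst c) ∧ a)%mv.
Proof. apply mvf_ext; simpl; ring. Qed.

Lemma homog_wedge p q a b : homog p a -> homog q b -> homog (p + q) (a ∧ b)%mv.
Proof.
  intros (a0 & a1 & a2) (b0 & b1 & b2).
  assert (ha : p <> 0%Z -> p <> 1%Z -> p <> 2%Z -> a = zero)
    by (intros; apply mvf_ext; [apply a0|apply a1|apply a1|apply a2]; auto).
  assert (hb : q <> 0%Z -> q <> 1%Z -> q <> 2%Z -> b = zero)
    by (intros; apply mvf_ext; [apply b0|apply b1|apply b1|apply b2]; auto).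
  destruct (Z.eq_dec p 0) as [->|p0]; [|destruct (Z.eq_dec p 1) as [->|p1];
    [|destruct (Z.eq_dec p 2) as [->|p2]; [|rewrite (ha p0 p1 p2); repeat split; intros; simpl; ring]]];
  (destruct (Z.eq_dec q 0) as [->|q0]; [|destruct (Z.eq_dec q 1) as [->|q1];
    [|destruct (Z.eq_dec q 2) as [->|q2]; [|rewrite (hb q0 q1 q2); repeat split; intros; simpl; ring]]]);
  repeat split; intros; simpl in *;
  try (rewrite a0 by lia); try (rewrite (proj1 (a1 ltac:(lia))));
  try (rewrite (proj2 (a1 ltac:(lia)))); try (rewrite a2 by lia);
  try (rewrite b0 by lia); try (rewrite (proj1 (b1 ltac:(lia))));
  try (rewrite (proj2 (b1 ltac:(lia)))); try (rewrite b2 by lia); try ring; try lia.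
Qed.

(** * The Schouten--Nijenhuis bracket *)

(** [act X f] is [X(f)], for the degree 1 part of [X]. *)
Definition act (X : mvf) (f : Cinf) : Cinf := (mvx X * cdx f + mvy X * cdy f)%Ci.
Definition dvg (X : mvf) : Cinf := (cdx (mvx X) + cdy (mvy X))%Ci.

Definition sgn (n : Z) : R := if Z.even n then 1 else -1.

Record is_schouten (br : mvf -> mvf -> mvf) : Prop := {
  br_plus_l : forall a b c, br (plus a b) c = plus (br a c) (br b c);
  br_plus_r : forall a b c, br a (plus b c) = plus (br a b) (br a c);
  br_scal_l : forall (t : R) a b, br (scal t a) b = scal t (br a b);
  br_scal_r : forall (t : R) a b, br a (scal t b) = scal t (br a b);
  br_homog : forall p q a b, homog p a -> homog q b -> homog (p + q - 1) (br a b);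
  br_antisym : forall p q a b, homog p a -> homog q b ->
    br a b = opp (scal (sgn ((p - 1) * (q - 1))) (br b a));
  br_jacobi : forall p q r a b c, homog p a -> homog q b -> homog r c ->
    br a (br b c) =
    plus (br (br a b) c) (scal (sgn ((p - 1) * (q - 1))) (br b (br a c)));
  br_leibniz : forall p q r a b c, homog p a -> homog q b -> homog r c ->
    br a (b ∧ c)%mv =
    plus (br a b ∧ c)%mv (scal (sgn ((p - 1) * q)) (b ∧ br a c)%mv);
  br_lie : forall X Y, homog 1 X -> homog 1 Y ->
    forall f, act (br X Y) f = (act X (act Y f) - act Y (act X f))%Ci;
  br_fn : forall X f, homog 1 X -> br X (fn f) = fn (act X f)
}.

(** Coordinate expression; in degree 2, [L_X (g d/dx ^ d/dy)] is
    [(X(g) - g div X) d/dx ^ d/dy].  [schouten_spec] and [schouten_unique]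
    identify it with the bracket characterised by [is_schouten]. *)
Definition schouten (a b : mvf) : mvf :=
  Mvf (act a (mv0 b) - act b (mv0 a))
      (act a (mvx b) - act b (mvx a) + mvxy a * cdy (mv0 b) + mvxy b * cdy (mv0 a))
      (act a (mvy b) - act b (mvy a) - mvxy a * cdx (mv0 b) - mvxy b * cdx (mv0 a))
      (act a (mvxy b) - mvxy b * dvg a - act b (mvxy a) + mvxy a * dvg b).

Lemma homog_cases k a : homog k a ->
  (k = 0%Z /\ exists f, a = Mvf f 0 0 0) \/
  (k = 1%Z /\ exists f g, a = Mvf 0 f g 0) \/
  (k = 2%Z /\ exists f, a = Mvf 0 0 0 f) \/ a = Mvf 0 0 0 0.
Proof.
  destruct a as [a0 ax ay axy]; intros (h0 & h1 & h2); simpl in *.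
  destruct (Z.eq_dec k 0) as [->|k0].
  { left; split; auto; exists a0.
    destruct h1 as [-> ->]; [lia|]; rewrite h2 by lia; reflexivity. }
  rewrite (h0 k0).
  destruct (Z.eq_dec k 1) as [->|k1].
  { right; left; split; auto; exists ax, ay; rewrite h2 by lia; reflexivity. }
  destruct (h1 k1) as [-> ->].
  destruct (Z.eq_dec k 2) as [->|k2].
  { right; right; left; split; auto; exists axy; reflexivity. }
  rewrite (h2 k2); auto.
Qed.

Ltac homog_destruct h :=
  apply homog_cases in h;
  destruct h as [[-> [? ->]]|[[-> [? [? ->]]]|[[-> [? ->]]| -> ]]].

Ltac mv_ring :=
  unfold schouten, act, dvg, sgn; simpl;
  repeat match goal with |- context [if Z.even ?u then _ else _] => destruct (Z.even u) end;
  apply mvf_ext; simpl; cder; rewrite ?ccst_m1; ring.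

Section HomogeneousBrackets.
Local Ltac t := intros; apply mvf_ext; unfold schouten, act, dvg; simpl; cder; ring.

Lemma schouten00 f g : schouten (Mvf f 0 0 0) (Mvf g 0 0 0) = Mvf 0 0 0 0.
Proof. t. Qed.
Lemma schouten01 f g h : schouten (Mvf f 0 0 0) (Mvf 0 g h 0) =
  Mvf (- (g * cdx f + h * cdy f)) 0 0 0.
Proof. t. Qed.
Lemma schouten10 f g h : schouten (Mvf 0 g h 0) (Mvf f 0 0 0) =
  Mvf (g * cdx f + h * cdy f) 0 0 0.
Proof. t. Qed.
Lemma schouten02 f g : schouten (Mvf f 0 0 0) (Mvf 0 0 0 g) =
  Mvf 0 (g * cdy f) (- (g * cdx f)) 0.
Proof. t. Qed.
Lemma schouten20 f g : schouten (Mvf 0 0 0 g) (Mvf f 0 0 0) =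
  Mvf 0 (g * cdy f) (- (g * cdx f)) 0.
Proof. t. Qed.
Lemma schouten11 f g h k : schouten (Mvf 0 f g 0) (Mvf 0 h k 0) =
  Mvf 0 (f * cdx h + g * cdy h - h * cdx f - k * cdy f)
        (f * cdx k + g * cdy k - h * cdx g - k * cdy g) 0.
Proof. t. Qed.
Lemma schouten12 f g h : schouten (Mvf 0 f g 0) (Mvf 0 0 0 h) =
  Mvf 0 0 0 (f * cdx h + g * cdy h - h * (cdx f + cdy g)).
Proof. t. Qed.
Lemma schouten21 f g h : schouten (Mvf 0 0 0 h) (Mvf 0 f g 0) =
  Mvf 0 0 0 (h * (cdx f + cdy g) - (f * cdx h + g * cdy h)).
Proof. t. Qed.
Lemma schouten22 f g : schouten (Mvf 0 0 0 f) (Mvf 0 0 0 g) = Mvf 0 0 0 0.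
Proof. t. Qed.
Lemma schouten_zero_l a : schouten (Mvf 0 0 0 0) a = Mvf 0 0 0 0.
Proof. t. Qed.
Lemma schouten_zero_r a : schouten a (Mvf 0 0 0 0) = Mvf 0 0 0 0.
Proof. t. Qed.
Lemma wedge0 f a : (Mvf f 0 0 0 ∧ a = Mvf (f * mv0 a) (f * mvx a) (f * mvy a) (f * mvxy a))%mv.
Proof. t. Qed.
Lemma wedge0r f a : (a ∧ Mvf f 0 0 0 = Mvf (f * mv0 a) (f * mvx a) (f * mvy a) (f * mvxy a))%mv.
Proof. t. Qed.
Lemma wedge11 f g h k : (Mvf 0 f g 0 ∧ Mvf 0 h k 0 = Mvf 0 0 0 (f * k - g * h))%mv.
Proof. t. Qed.
Lemma wedge12 f g h : (Mvf 0 f g 0 ∧ Mvf 0 0 0 h = Mvf 0 0 0 0)%mv.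
Proof. t. Qed.
Lemma wedge21 f g h : (Mvf 0 0 0 h ∧ Mvf 0 f g 0 = Mvf 0 0 0 0)%mv.
Proof. t. Qed.
Lemma wedge22 f g : (Mvf 0 0 0 f ∧ Mvf 0 0 0 g = Mvf 0 0 0 0)%mv.
Proof. t. Qed.
End HomogeneousBrackets.

Lemma cmul0 f : (f * 0 = 0)%Ci.
Proof. ring. Qed.

Ltac graded_reduce :=
  repeat first
    [ rewrite schouten_zero_l | rewrite schouten_zero_r | rewrite schouten00
    | rewrite schouten01 | rewrite schouten10 | rewrite schouten02
    | rewrite schouten20 | rewrite schouten11 | rewrite schouten12
    | rewrite schouten21 | rewrite schouten22
    | rewrite wedge0; cbn [mv0 mvx mvy mvxy]; rewrite ?cmul0
    | rewrite wedge0r; cbn [mv0 mvx mvy mvxy]; rewrite ?cmul0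
    | rewrite wedge11 | rewrite wedge12 | rewrite wedge21 | rewrite wedge22 ];
  mv_ring.

Lemma schouten_jacobi p q r a b c : homog p a -> homog q b -> homog r c ->
  schouten a (schouten b c) =
  plus (schouten (schouten a b) c)
       (scal (sgn ((p - 1) * (q - 1))) (schouten b (schouten a c))).
Proof.
  intros ha hb hc; homog_destruct ha; homog_destruct hb; homog_destruct hc;
    graded_reduce.
Qed.

Lemma schouten_spec : is_schouten schouten.
Proof.
  constructor.
  - intros; mv_ring.
  - intros; mv_ring.
  - intros; mv_ring.
  - intros; mv_ring.
  - intros p q a b ha hb; homog_destruct ha; homog_destruct hb; unfold schouten, act, dvg;
      repeat split; intros; simpl in *; try lia; cder; ring.
  - intros p q a b ha hb; homog_destruct ha; homog_destruct hb; mv_ring.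
  - exact schouten_jacobi.
  - intros p q r a b c ha hb hc; homog_destruct ha; homog_destruct hb; homog_destruct hc; graded_reduce.
  - intros X Y hX hY f; apply homog_cases in hX; apply homog_cases in hY.
    destruct hX as [[hk _]|[[_ [? [? ->]]]|[[hk _]| -> ]]]; try discriminate hk;
    destruct hY as [[hk _]|[[_ [? [? ->]]]|[[hk _]| -> ]]]; try discriminate hk;
    unfold schouten, act; simpl; cder; ring.
  - intros X f hX; apply homog_cases in hX.
    destruct hX as [[hk _]|[[_ [? [? ->]]]|[[hk _]| -> ]]]; try discriminate hk; mv_ring.
Qed.

Lemma homog0 f : homog 0 (fn f).
Proof. repeat split; intros; try reflexivity; lia. Qed.

Lemma homog1 f g : homog 1 (Mvf 0 f g 0).
Proof. repeat split; intros; try reflexivity; lia. Qed.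

Lemma homog2 f : homog 2 (Mvf 0 0 0 f).
Proof. repeat split; intros; try reflexivity; lia. Qed.

Lemma homog_out k a : homog k a -> (k < 0 \/ 2 < k)%Z -> a = zero.
Proof.
  intros h hk; apply homog_cases in h.
  destruct h as [[-> _]|[[-> _]|[[-> _]|h]]]; try lia; exact h.
Qed.

Lemma schouten_unique br :
  is_schouten br -> forall a b, br a b = schouten a b.
Proof.
  intros H; pose proof schouten_spec as S.
  assert (anti : forall p q a b, homog p a -> homog q b ->
    br a b = schouten a b -> br b a = schouten b a).
  { intros p q a b ha hb e.
    now rewrite (br_antisym _ H q p b a hb ha), (br_antisym _ S q p b a hb ha), e. }
  assert (leib : forall p q r a b c, homog p a -> homog q b -> homog r c ->
    br a b = schouten a b -> br a c = schouten a c ->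
    br a (b ∧ c)%mv = schouten a (b ∧ c)%mv).
  { intros p q r a b c ha hb hc e e'.
    now rewrite (br_leibniz _ H p q r), (br_leibniz _ S p q r), e, e'. }
  assert (out : forall p q a b, homog p a -> homog q b ->
    (p + q - 1 < 0 \/ 2 < p + q - 1)%Z -> br a b = schouten a b).
  { intros p q a b ha hb hpq; transitivity (@zero mvf_AbelianGroup).
    - now apply (homog_out _ _ (br_homog _ H p q a b ha hb)).
    - now symmetry; apply (homog_out _ _ (br_homog _ S p q a b ha hb)). }
  assert (e00 : forall f g, br (fn f) (fn g) = schouten (fn f) (fn g)).
  { intros; apply (out 0%Z 0%Z); try apply homog0; lia. }
  assert (e10 : forall f g h, br (Mvf 0 f g 0) (fn h) = schouten (Mvf 0 f g 0) (fn h)).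
  { intros; rewrite (br_fn _ H), (br_fn _ S); auto using homog1. }
  assert (e01 : forall f g h, br (fn h) (Mvf 0 f g 0) = schouten (fn h) (Mvf 0 f g 0)).
  { intros; apply (anti 1%Z 0%Z); auto using homog0, homog1. }
  assert (e11 : forall f g h k,
    br (Mvf 0 f g 0) (Mvf 0 h k 0) = schouten (Mvf 0 f g 0) (Mvf 0 h k 0)).
  { intros f g h k.
    set (X := Mvf 0 f g 0); set (Y := Mvf 0 h k 0).
    assert (hX : homog 1 X) by apply homog1; assert (hY : homog 1 Y) by apply homog1.
    pose proof (br_homog _ H _ _ _ _ hX hY) as u; simpl in u.
    pose proof (br_homog _ S _ _ _ _ hX hY) as v; simpl in v.
    assert (w : forall t, act (br X Y) t = act (schouten X Y) t)
      by (intros t; now rewrite (br_lie _ H), (br_lie _ S)).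
    assert (ex : forall Z, act Z cx = mvx Z)
      by (intros Z; unfold act; cder; ring).
    assert (ey : forall Z, act Z cy = mvy Z)
      by (intros Z; unfold act; cder; ring).
    apply mvf_ext.
    - now rewrite (proj1 u), (proj1 v) by lia.
    - now rewrite <- ex, w, ex.
    - now rewrite <- ey, w, ey.
    - now rewrite (proj2 (proj2 u)), (proj2 (proj2 v)) by lia. }
  assert (vol : forall f, Mvf 0 0 0 f = (Mvf 0 f 0 0 ∧ Mvf 0 0 1 0)%mv)
    by (intros; apply mvf_ext; simpl; ring).
  assert (e02 : forall f g, br (fn f) (Mvf 0 0 0 g) = schouten (fn f) (Mvf 0 0 0 g)).
  { intros; rewrite vol; apply (leib 0%Z 1%Z 1%Z); auto using homog0, homog1. }
  assert (e12 : forall f g h,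
    br (Mvf 0 f g 0) (Mvf 0 0 0 h) = schouten (Mvf 0 f g 0) (Mvf 0 0 0 h)).
  { intros; rewrite vol; apply (leib 1%Z 1%Z 1%Z); auto using homog1. }
  assert (e20 : forall f g, br (Mvf 0 0 0 g) (fn f) = schouten (Mvf 0 0 0 g) (fn f)).
  { intros; apply (anti 0%Z 2%Z); auto using homog0, homog2. }
  assert (e21 : forall f g h,
    br (Mvf 0 0 0 h) (Mvf 0 f g 0) = schouten (Mvf 0 0 0 h) (Mvf 0 f g 0)).
  { intros; apply (anti 1%Z 2%Z); auto using homog1, homog2. }
  assert (e22 : forall f g, br (Mvf 0 0 0 f) (Mvf 0 0 0 g) = schouten (Mvf 0 0 0 f) (Mvf 0 0 0 g)).
  { intros; apply (out 2%Z 2%Z); auto using homog2; lia. }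
  assert (dec : forall a, a = plus (fn (mv0 a)) (plus (Mvf 0 (mvx a) (mvy a) 0) (Mvf 0 0 0 (mvxy a))))
    by (intros; apply mvf_ext; simpl; ring).
  intros a b; rewrite (dec a), (dec b).
  rewrite !(br_plus_l _ H), !(br_plus_l _ S), !(br_plus_r _ H), !(br_plus_r _ S).
  now rewrite e00, e01, e02, e10, e11, e12, e20, e21, e22.
Qed.

(** * Subquotients of real vector spaces *)

Record subspace (V : ModuleSpace R_Ring) := Subspace {
  mem :> V -> Prop;
  mem_zero : mem zero;
  mem_plus : forall u v, mem u -> mem v -> mem (plus u v);
  mem_scal : forall (c : R) u, mem u -> mem (scal c u)
}.
Arguments mem {V} _ _.
Arguments mem_zero {V} _.
Arguments mem_plus {V} _ _ _ _ _.
Arguments mem_scal {V} _ _ _ _.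

Lemma mem_opp (V : ModuleSpace R_Ring) (B : subspace V) u : B u -> B (opp u).
Proof. intros h; rewrite <- scal_opp_one; now apply mem_scal. Qed.

Lemma mem_minus (V : ModuleSpace R_Ring) (B : subspace V) u v :
  B u -> B v -> B (minus u v).
Proof. intros hu hv; apply mem_plus; auto using mem_opp. Qed.

(** [subquot Z B] is the quotient of [Z] by [B] (for [B] contained in [Z]); its
    elements are the cosets [z + B], as predicates on the ambient space. *)
Record subquot {V : ModuleSpace R_Ring} (Z B : subspace V) := Subquot {
  coset :> V -> Prop;
  coset_rep : exists2 z, Z z & coset = (fun w => B (minus w z))
}.
Arguments coset {V Z B} _ _.
Arguments coset_rep {V Z B} _.

Lemma subquot_ext (V : ModuleSpace R_Ring) (Z B : subspace V) (s t : subquot Z B) :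
  coset s = coset t -> s = t.
Proof.
  destruct s as [s hs], t as [t ht]; simpl; intros e; subst t.
  f_equal; apply proof_irrelevance.
Qed.

Definition cls {V : ModuleSpace R_Ring} {Z B : subspace V} (z : V) (hz : Z z) :
  subquot Z B :=
  Subquot V Z B (fun w => B (minus w z)) (ex_intro2 _ _ z hz eq_refl).

Lemma subquot_ind' (V : ModuleSpace R_Ring) (Z B : subspace V) (s : subquot Z B) :
  exists z (hz : Z z), s = cls z hz.
Proof.
  destruct (coset_rep s) as [z hz e]; exists z, hz; now apply subquot_ext.
Qed.

Lemma cls_eq (V : ModuleSpace R_Ring) (Z B : subspace V) z z' (hz : Z z) (hz' : Z z') :
  @cls V Z B z hz = cls z' hz' <-> B (minus z z').
Proof.
  split.
  - intros e; apply (f_equal (fun s => coset s z)) in e; simpl in e.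
    rewrite <- e, minus_eq_zero; apply mem_zero.
  - intros h; apply subquot_ext, functional_extensionality; intros w; simpl.
    apply propositional_extensionality; split; intros h'.
    + rewrite (minus_trans z); now apply mem_plus.
    + rewrite (minus_trans z'); apply mem_plus; auto.
      rewrite <- opp_minus; now apply mem_opp.
Qed.

Definition sq_plus_set {V : ModuleSpace R_Ring} {Z B : subspace V} (s t : subquot Z B) :
  V -> Prop :=
  fun w => exists u v, s u /\ t v /\ w = plus u v.

Definition sq_scal_set {V : ModuleSpace R_Ring} {Z B : subspace V} (c : R) (s : subquot Z B) :
  V -> Prop :=
  fun w => exists u, s u /\ B (minus w (scal c u)).

Lemma cls_congr (V : ModuleSpace R_Ring) (Z B : subspace V) z z' (hz : Z z) (hz' : Z z') :
  z = z' -> @cls V Z B z hz = cls z' hz'.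
Proof. intros ->; apply cls_eq; rewrite minus_eq_zero; apply mem_zero. Qed.

Lemma minus_plus_plus (V : AbelianGroup) (a b c d : V) :
  minus (plus a b) (plus c d) = plus (minus a c) (minus b d).
Proof.
  unfold minus; rewrite opp_plus, <- !plus_assoc; f_equal.
  now rewrite !plus_assoc, (plus_comm b).
Qed.

Lemma minus_plus_r (V : AbelianGroup) (a b : V) : minus (plus a b) b = a.
Proof.
  transitivity (plus a (plus b (opp b))); [symmetry; apply plus_assoc|].
  rewrite (plus_opp_r b); apply plus_zero_r.
Qed.

Lemma plus_minus_r (V : AbelianGroup) (a b : V) : plus (minus a b) b = a.
Proof.
  transitivity (plus a (plus (opp b) b)); [symmetry; apply plus_assoc|].
  rewrite (plus_opp_l b); apply plus_zero_r.
Qed.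

Lemma scal_minus (V : ModuleSpace R_Ring) (c : R) (a b : V) :
  scal c (minus a b) = minus (scal c a) (scal c b).
Proof.
  unfold minus; rewrite <- (@scal_opp_r R_Ring V); exact (@scal_distr_l R_Ring V c a (opp b)).
Qed.

Lemma sq_plus_set_cls (V : ModuleSpace R_Ring) (Z B : subspace V) z z' (hz : Z z) (hz' : Z z') :
  sq_plus_set (@cls V Z B z hz) (cls z' hz') = (fun w => B (minus w (plus z z'))).
Proof.
  apply functional_extensionality; intros w; apply propositional_extensionality; split.
  - intros (u & v & hu & hv & ->); simpl in *.
    rewrite minus_plus_plus; now apply mem_plus.
  - intros h; exists (plus (minus w (plus z z')) z), z'; simpl; repeat split.
    + rewrite minus_plus_r; exact h.
    + rewrite minus_eq_zero; apply mem_zero.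
    + transitivity (plus (minus w (plus z z')) (plus z z'));
        [symmetry; exact (plus_minus_r V w (plus z z')) | apply plus_assoc].
Qed.

Lemma sq_scal_set_cls (V : ModuleSpace R_Ring) (Z B : subspace V) c z (hz : Z z) :
  sq_scal_set c (@cls V Z B z hz) = (fun w => B (minus w (scal c z))).
Proof.
  apply functional_extensionality; intros w; apply propositional_extensionality; split.
  - intros (u & hu & h); simpl in *.
    rewrite (minus_trans (scal c u)); apply mem_plus; auto.
    rewrite <- scal_minus; now apply mem_scal.
  - intros h; exists z; split; auto; simpl.
    rewrite minus_eq_zero; apply mem_zero.
Qed.

Lemma sq_plus_rep (V : ModuleSpace R_Ring) (Z B : subspace V) (s t : subquot Z B) :
  exists2 z, Z z & sq_plus_set s t = (fun w => B (minus w z)).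
Proof.
  destruct (subquot_ind' _ _ _ s) as (z & hz & ->).
  destruct (subquot_ind' _ _ _ t) as (z' & hz' & ->).
  exists (plus z z'); [now apply mem_plus | apply sq_plus_set_cls].
Qed.

Lemma sq_scal_rep (V : ModuleSpace R_Ring) (Z B : subspace V) c (s : subquot Z B) :
  exists2 z, Z z & sq_scal_set c s = (fun w => B (minus w z)).
Proof.
  destruct (subquot_ind' _ _ _ s) as (z & hz & ->).
  exists (scal c z); [now apply mem_scal | apply sq_scal_set_cls].
Qed.

Definition sq_plus {V : ModuleSpace R_Ring} {Z B : subspace V} (s t : subquot Z B) :
  subquot Z B := Subquot V Z B (sq_plus_set s t) (sq_plus_rep V Z B s t).
Definition sq_scal {V : ModuleSpace R_Ring} {Z B : subspace V} (c : R) (s : subquot Z B) :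
  subquot Z B := Subquot V Z B (sq_scal_set c s) (sq_scal_rep V Z B c s).
Definition sq_zero {V : ModuleSpace R_Ring} {Z B : subspace V} : subquot Z B :=
  cls zero (mem_zero Z).
Definition sq_opp {V : ModuleSpace R_Ring} {Z B : subspace V} (s : subquot Z B) :
  subquot Z B := sq_scal (-1) s.

Lemma sq_plus_cls (V : ModuleSpace R_Ring) (Z B : subspace V) z z' (hz : Z z) (hz' : Z z') :
  sq_plus (@cls V Z B z hz) (cls z' hz') = cls (plus z z') (mem_plus Z z z' hz hz').
Proof. apply subquot_ext, sq_plus_set_cls. Qed.

Lemma sq_scal_cls (V : ModuleSpace R_Ring) (Z B : subspace V) c z (hz : Z z) :
  sq_scal c (@cls V Z B z hz) = cls (scal c z) (mem_scal Z c z hz).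
Proof. apply subquot_ext, sq_scal_set_cls. Qed.

Ltac sq_reps :=
  repeat match goal with s : subquot _ _ |- _ =>
    let z := fresh "z" in let hz := fresh "hz" in
    destruct (subquot_ind' _ _ _ s) as (z & hz & ->) end.

Ltac sq_solve :=
  intros; sq_reps; unfold sq_opp, sq_zero;
  repeat first [rewrite sq_plus_cls | rewrite sq_scal_cls]; apply cls_congr.

Definition subquot_AbelianMonoid_mixin (V : ModuleSpace R_Ring) (Z B : subspace V) :
  AbelianMonoid.mixin_of (subquot Z B).
Proof.
  refine (AbelianMonoid.Mixin (subquot Z B) sq_plus sq_zero _ _ _); sq_solve.
  - apply plus_comm.
  - apply plus_assoc.
  - apply plus_zero_r.
Defined.
Canonical subquot_AbelianMonoid (V : ModuleSpace R_Ring) (Z B : subspace V) :=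
  AbelianMonoid.Pack (subquot Z B) (subquot_AbelianMonoid_mixin V Z B) (subquot Z B).

Definition subquot_AbelianGroup_mixin (V : ModuleSpace R_Ring) (Z B : subspace V) :
  AbelianGroup.mixin_of (subquot_AbelianMonoid V Z B).
Proof.
  refine (AbelianGroup.Mixin (subquot_AbelianMonoid V Z B) sq_opp _).
  unfold plus, zero; simpl; sq_solve.
  change (-1) with (opp (@one R_Ring)); rewrite scal_opp_one; exact (@plus_opp_r V z).
Defined.
Canonical subquot_AbelianGroup (V : ModuleSpace R_Ring) (Z B : subspace V) :=
  AbelianGroup.Pack (subquot Z B)
    (AbelianGroup.Class _ _ (subquot_AbelianGroup_mixin V Z B)) (subquot Z B).

Definition subquot_ModuleSpace_mixin (V : ModuleSpace R_Ring) (Z B : subspace V) :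
  ModuleSpace.mixin_of R_Ring (subquot_AbelianGroup V Z B).
Proof.
  assert (ax1 : forall (x y : R) (u : subquot Z B),
    sq_scal x (sq_scal y u) = sq_scal (x * y) u)
    by (sq_solve; apply (@scal_assoc R_Ring)).
  assert (ax2 : forall u : subquot Z B, sq_scal 1 u = u)
    by (sq_solve; apply (@scal_one R_Ring)).
  assert (ax3 : forall (x : R) (u v : subquot Z B),
    sq_scal x (sq_plus u v) = sq_plus (sq_scal x u) (sq_scal x v))
    by (sq_solve; apply (@scal_distr_l R_Ring)).
  assert (ax4 : forall (x y : R) (u : subquot Z B),
    sq_scal (x + y) u = sq_plus (sq_scal x u) (sq_scal y u))
    by (sq_solve; apply (@scal_distr_r R_Ring)).
  exact (ModuleSpace.Mixin R_Ring (subquot_AbelianGroup V Z B) sq_scal ax1 ax2 ax3 ax4).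
Defined.
Canonical subquot_ModuleSpace (V : ModuleSpace R_Ring) (Z B : subspace V) :=
  ModuleSpace.Pack R_Ring (subquot Z B)
    (ModuleSpace.Class _ _ _ (subquot_ModuleSpace_mixin V Z B)) (subquot Z B).

Fixpoint lincomb {V : ModuleSpace R_Ring} (cs : list R) (es : list V) : V :=
  match cs, es with
  | c :: cs, e :: es => plus (scal c e) (lincomb cs es)
  | _, _ => zero
  end.

Definition lin_indep {V : ModuleSpace R_Ring} (es : list V) : Prop :=
  forall cs, length cs = length es -> lincomb cs es = zero ->
    List.Forall (fun c => c = 0) cs.

Definition spanning {V : ModuleSpace R_Ring} (es : list V) : Prop :=
  forall v, exists2 cs, length cs = length es & v = lincomb cs es.

Definition is_basis {V : ModuleSpace R_Ring} (es : list V) : Prop :=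
  lin_indep es /\ spanning es.

(** * Poisson cohomology *)

Record poisson := Poisson {
  bivector :> mvf;
  bivector_homog : homog 2 bivector;
  bivector_jacobi : schouten bivector bivector = zero
}.

Definition dP (P : poisson) (a : mvf) : mvf := schouten P a.

Lemma dP_homog (P : poisson) k a : homog k a -> homog (k + 1) (dP P a).
Proof.
  intros h; replace (k + 1)%Z with (2 + k - 1)%Z by lia.
  apply (br_homog _ schouten_spec); auto using bivector_homog.
Qed.

Lemma dP_plus (P : poisson) a b : dP P (plus a b) = plus (dP P a) (dP P b).
Proof. apply (br_plus_r _ schouten_spec). Qed.

Lemma dP_scal (P : poisson) (c : R) a : dP P (scal c a) = scal c (dP P a).
Proof. apply (br_scal_r _ schouten_spec). Qed.

Lemma dP_zero (P : poisson) : dP P zero = zero.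
Proof.
  rewrite <- (scal_zero_l (@zero mvf_ModuleSpace)) at 1.
  rewrite (dP_scal P); apply (@scal_zero_l R_Ring).
Qed.

Lemma mvf_eq_opp (a : mvf) : a = scal (-1) a -> a = zero.
Proof.
  intros e; apply mvf_ext; apply Cinf_ext; intros x y.
  - apply (f_equal (fun m => mv0 m x y)) in e; simpl in *; lra.
  - apply (f_equal (fun m => mvx m x y)) in e; simpl in *; lra.
  - apply (f_equal (fun m => mvy m x y)) in e; simpl in *; lra.
  - apply (f_equal (fun m => mvxy m x y)) in e; simpl in *; lra.
Qed.

Lemma dP_dP (P : poisson) k a : homog k a -> dP P (dP P a) = zero.
Proof.
  intros h; unfold dP.
  pose proof (bivector_homog P) as hP.
  pose proof (br_jacobi _ schouten_spec 2 2 k P P a hP hP h) as e.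
  rewrite (bivector_jacobi P) in e.
  change (sgn ((2 - 1) * (2 - 1))) with (-1) in e.
  replace (schouten zero a) with (@zero mvf_AbelianGroup) in e
    by (symmetry; apply schouten_zero_l).
  rewrite plus_zero_l in e.
  now apply mvf_eq_opp.
Qed.

Lemma homog_zero k : homog k zero.
Proof. repeat split. Qed.

Lemma homog_plus k a b : homog k a -> homog k b -> homog k (plus a b).
Proof.
  intros (a0 & a1 & a2) (b0 & b1 & b2).
  split; [|split]; intros h; simpl.
  - rewrite a0, b0 by auto; ring.
  - destruct (a1 h) as [-> ->], (b1 h) as [-> ->]; split; ring.
  - rewrite a2, b2 by auto; ring.
Qed.

Lemma homog_scal k (c : R) a : homog k a -> homog k (scal c a).
Proof.
  intros (a0 & a1 & a2).
  split; [|split]; intros h; simpl.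
  - rewrite a0 by auto; ring.
  - destruct (a1 h) as [-> ->]; split; ring.
  - rewrite a2 by auto; ring.
Qed.

Definition cocycles (P : poisson) (k : Z) : subspace mvf_ModuleSpace.
Proof.
  refine (Subspace mvf_ModuleSpace (fun a => homog k a /\ dP P a = zero) _ _ _).
  - split; [apply homog_zero | apply dP_zero].
  - intros a b [ha ea] [hb eb]; split; [now apply homog_plus|].
    rewrite (dP_plus P), ea, eb; apply (@plus_zero_r mvf_AbelianMonoid).
  - intros c a [ha ea]; split; [now apply homog_scal|].
    rewrite (dP_scal P), ea; apply (@scal_zero_r R_Ring).
Defined.

Definition coboundaries (P : poisson) (k : Z) : subspace mvf_ModuleSpace.
Proof.
  refine (Subspace mvf_ModuleSpace (fun a => exists2 b, homog (k - 1) b & a = dP P b) _ _ _).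
  - exists zero; [apply homog_zero | symmetry; apply dP_zero].
  - intros a a' [b hb ->] [b' hb' ->]; exists (plus b b'); [now apply homog_plus|].
    symmetry; apply dP_plus.
  - intros c a [b hb ->]; exists (scal c b); [now apply homog_scal|].
    symmetry; apply dP_scal.
Defined.

Lemma coboundary_cocycle P k a : coboundaries P k a -> cocycles P k a.
Proof.
  intros [b hb ->]; split.
  - replace k with (k - 1 + 1)%Z by lia; now apply dP_homog.
  - exact (dP_dP P (k - 1)%Z b hb).
Qed.

Definition poisson_cohomology (P : poisson) (k : Z) : ModuleSpace R_Ring :=
  subquot_ModuleSpace mvf_ModuleSpace (cocycles P k) (coboundaries P k).

Definition class (P : poisson) (k : Z) (a : mvf) (ha : cocycles P k a) :
  poisson_cohomology P k := cls a ha.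
Arguments class {P k a} ha.

(** * The Poisson structure [(x^2 + y^2) d/dx ^ d/dy] *)

Definition r2 : Cinf := (cx * cx + cy * cy)%Ci.
Definition Vol : mvf := (ddx ∧ ddy)%mv.
Definition dtheta : mvf := minus (fn cx ∧ ddy)%mv (fn cy ∧ ddx)%mv.
Definition Dr : mvf := plus (fn cx ∧ ddx)%mv (fn cy ∧ ddy)%mv.

Lemma bivector_poisson (f : Cinf) : schouten (fn f ∧ Vol)%mv (fn f ∧ Vol)%mv = zero.
Proof. mv_ring. Qed.

Lemma bivector_homog2 (f : Cinf) : homog 2 (fn f ∧ Vol)%mv.
Proof.
  repeat split; intros; simpl; try ring; lia.
Qed.

Definition Pi_r2 : poisson :=
  Poisson (fn r2 ∧ Vol)%mv (bivector_homog2 r2) (bivector_poisson r2).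

(* Main.v *)
Require Import Defs.
From Stdlib Require Import Reals ZArith List.
From Coquelicot Require Import Coquelicot.
Import ListNotations.
From Stdlib Require Import Lra Lia.

(** Let [D = x d/dx + y d/dy].  The operator [I_n a (x, y) = int_0^1 t^n a(t x, t y) dt]
    preserves smoothness and inverts [D + n + 1], and [D a = 0] only for constant
    [a]; hence Hadamard's lemma [a = a(0) + x I_0 a_x + y I_0 a_y] holds and [D]
    maps onto the functions vanishing at the origin.

    The differential sends [h] to [r^2 (h_y d/dx - h_x d/dy)] and
    [X = f d/dx + g d/dy] to [(r^2 div X - 2 (x f + y g)) Vol].

    Degree 1: if [X] is a cocycle and [p = div X / 2], then
    [x (f - x p) + y (g - y p) = 0], so [X = p Dr + q dtheta] for a smooth [q], and
    closedness becomes [D p + dtheta(q) = 0].  Choosing [h] with [D h = q(0) - q],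
    the function [dtheta(h) - p] is killed by [D], and
    [X = q(0) dtheta + p(0) Dr + dP h].

    Degree 2: write [k = k(0) + x u + y v] and [w = (u_x + v_y) / 2].  Then
    [dP (-(u d/dx + v d/dy) / 2) = (x u + y v - r^2 w) Vol], and
    [dP (h Dr) = r^2 (D h) Vol] absorbs [r^2 (w - w(0))].

    Independence is seen on the Taylor coefficients of order at most 2 at the
    origin. *)

(** * Continuity and differentiability in two variables *)

Lemma continuity_2d_pt_comp_2d (f g h : R -> R -> R) (x y : R) :
  continuity_2d_pt f (g x y) (h x y) ->
  continuity_2d_pt g x y -> continuity_2d_pt h x y ->
  continuity_2d_pt (fun u v => f (g u v) (h u v)) x y.
Proof.
  intros hf hg hh eps.
  destruct (hf eps) as [d hd].
  destruct (hg d) as [d1 h1], (hh d) as [d2 h2].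
  exists (mkposreal _ (Rmin_stable_in_posreal d1 d2)); simpl; intros u v hu hv.
  apply hd.
  - apply h1; [apply (Rlt_le_trans _ _ _ hu), Rmin_l | apply (Rlt_le_trans _ _ _ hv), Rmin_l].
  - apply h2; [apply (Rlt_le_trans _ _ _ hu), Rmin_r | apply (Rlt_le_trans _ _ _ hv), Rmin_r].
Qed.

Lemma continuity_2d_pt_pow_snd n x y : continuity_2d_pt (fun _ t => t ^ n) x y.
Proof.
  apply (continuity_1d_2d_pt_comp (fun t => t ^ n) (fun _ t => t)).
  - apply derivable_continuous_pt, derivable_pt_pow.
  - apply continuity_2d_pt_id2.
Qed.

Lemma continuity_2d_pt_continuous_snd (f : R -> R -> R) x y :
  continuity_2d_pt f x y -> continuous (fun t => f x t) y.
Proof.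
  intros hf; apply continuity_pt_filterlim, continuity_pt_locally; intros eps.
  destruct (hf eps) as [d hd]; exists d; intros v hv.
  apply hd; [rewrite Rminus_diag, Rabs_R0; apply cond_pos | exact hv].
Qed.

(** Total differentiability follows from continuity of the partial derivative in [x] and existence
    of the one in [y]. It is what the chain rule along rays needs. *)
Lemma cfun_differentiable (a : Cinf) x y :
  differentiable_pt_lim a x y (cdx a x y) (cdy a x y).
Proof.
  apply filterdiff_differentiable_pt_lim.
  apply (is_derive_filterdiff a x y (cdx a)).
  - apply filter_forall; intros [u v].
    apply Derive_correct, smooth_ex_dx, cfun_smooth.
  - apply Derive_correct, smooth_ex_dy, cfun_smooth.
  - apply continuity_2d_pt_filterlim, smooth_cont, cfun_smooth.
Qed.

(** * The Euler operator and moments along rays *)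

Definition euler (a : Cinf) : Cinf := (cx * cdx a + cy * cdy a)%Ci.

Lemma is_derive_ray (a : Cinf) x y t :
  is_derive (fun s => a (s * x) (s * y)) t
    (x * cdx a (t * x) (t * y) + y * cdy a (t * x) (t * y)).
Proof.
  apply is_derive_Reals.
  rewrite (Rmult_comm x), (Rmult_comm y).
  apply (derivable_pt_lim_comp_2d a (fun s => s * x) (fun s => s * y)).
  - apply cfun_differentiable.
  - apply is_derive_Reals; auto_derive; trivial; ring.
  - apply is_derive_Reals; auto_derive; trivial; ring.
Qed.

(** The moments of [a] along the segment from the origin to [(x, y)]. *)
Definition ray_int (n : nat) (a : R -> R -> R) : R -> R -> R :=
  fun x y => RInt (fun t => t ^ n * a (t * x) (t * y)) 0 1.

(** Arbitrary [g] and [h] let one statement serve both partial derivatives: one of them is the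
    varying parameter, the other a frozen coordinate. *)
Lemma ray_integrand_continuity_2d n (a : Cinf) (g h : R -> R -> R) x t :
  continuity_2d_pt g x t -> continuity_2d_pt h x t ->
  continuity_2d_pt (fun u s => s ^ n * a (s * g u s) (s * h u s)) x t.
Proof.
  intros hg hh; apply continuity_2d_pt_mult; [apply continuity_2d_pt_pow_snd|].
  apply (continuity_2d_pt_comp_2d a (fun u s => s * g u s) (fun u s => s * h u s)).
  - apply smooth_cont, cfun_smooth.
  - apply continuity_2d_pt_mult; [apply continuity_2d_pt_id2 | exact hg].
  - apply continuity_2d_pt_mult; [apply continuity_2d_pt_id2 | exact hh].
Qed.

Lemma continuous_ray_integrand n (a : Cinf) x y t :
  continuous (fun s => s ^ n * a (s * x) (s * y)) t.
Proof.
  apply (continuity_2d_pt_continuous_snd (fun u s => s ^ n * a (s * u) (s * y)) x t).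
  apply (ray_integrand_continuity_2d n a (fun u _ => u) (fun _ _ => y)).
  - apply continuity_2d_pt_id1.
  - apply continuity_2d_pt_const.
Qed.

Lemma ex_RInt_ray_integrand n (a : Cinf) x y :
  ex_RInt (fun t => t ^ n * a (t * x) (t * y)) 0 1.
Proof.
  apply (ex_RInt_continuous (V := R_CompleteNormedModule)); intros.
  apply continuous_ray_integrand.
Qed.

(** Differentiation under the integral sign. The inner derivative of [t * x] contributes a factor
    [t], which raises the moment by one; this is why all moments are considered at once. *)
Lemma is_derive_ray_int_x n (a : Cinf) x y :
  is_derive (fun u => ray_int n a u y) x (ray_int (S n) (cdx a) x y).
Proof.
  assert (hd : forall u t, is_derive (fun z => t ^ n * a (t * z) (t * y)) u
                             (t ^ S n * cdx a (t * u) (t * y))).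
  { intros u t; replace (t ^ S n * cdx a (t * u) (t * y))
      with (t ^ n * (t * cdx a (t * u) (t * y))) by (simpl; ring).
    apply is_derive_scal, (is_derive_comp (fun z => a z (t * y)) (fun z => t * z)).
    - apply Derive_correct, smooth_ex_dx, cfun_smooth.
    - auto_derive; trivial; ring. }
  assert (hD : forall u t, Derive (fun z => t ^ n * a (t * z) (t * y)) u =
                             t ^ S n * cdx a (t * u) (t * y))
    by (intros; apply is_derive_unique, hd).
  unfold ray_int; rewrite <- (RInt_ext (fun t => Derive (fun u => t ^ n * a (t * u) (t * y)) x))
    by (intros; apply hD).
  apply (is_derive_RInt_param (fun u t => t ^ n * a (t * u) (t * y))).
  - apply filter_forall; intros u t _; eexists; apply hd.
  - intros t _; eapply continuity_2d_pt_ext; [intros; symmetry; apply hD|].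
    apply (ray_integrand_continuity_2d (S n) (cdx a) (fun u _ => u) (fun _ _ => y)).
    + apply continuity_2d_pt_id1.
    + apply continuity_2d_pt_const.
  - apply filter_forall; intros u; apply ex_RInt_ray_integrand.
Qed.

Lemma is_derive_ray_int_y n (a : Cinf) x y :
  is_derive (fun v => ray_int n a x v) y (ray_int (S n) (cdy a) x y).
Proof.
  assert (hd : forall v t, is_derive (fun z => t ^ n * a (t * x) (t * z)) v
                             (t ^ S n * cdy a (t * x) (t * v))).
  { intros v t; replace (t ^ S n * cdy a (t * x) (t * v))
      with (t ^ n * (t * cdy a (t * x) (t * v))) by (simpl; ring).
    apply is_derive_scal, (is_derive_comp (fun z => a (t * x) z) (fun z => t * z)).
    - apply Derive_correct, smooth_ex_dy, cfun_smooth.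
    - auto_derive; trivial; ring. }
  assert (hD : forall v t, Derive (fun z => t ^ n * a (t * x) (t * z)) v =
                             t ^ S n * cdy a (t * x) (t * v))
    by (intros; apply is_derive_unique, hd).
  unfold ray_int; rewrite <- (RInt_ext (fun t => Derive (fun v => t ^ n * a (t * x) (t * v)) y))
    by (intros; apply hD).
  apply (is_derive_RInt_param (fun v t => t ^ n * a (t * x) (t * v))).
  - apply filter_forall; intros v t _; eexists; apply hd.
  - intros t _; eapply continuity_2d_pt_ext; [intros; symmetry; apply hD|].
    apply (ray_integrand_continuity_2d (S n) (cdy a) (fun _ _ => x) (fun v _ => v)).
    + apply continuity_2d_pt_const.
    + apply continuity_2d_pt_id1.
  - apply filter_forall; intros v; apply ex_RInt_ray_integrand.
Qed.

(** Uniform continuity of [a] on a compact box controls the integrands for all [t] in [[0, 1]]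
    simultaneously. *)
Lemma ray_int_continuity_2d n (a : Cinf) x y : continuity_2d_pt (ray_int n a) x y.
Proof.
  intros eps.
  (* The square of half-side [M] contains the segments from the origin to every point whose
     coordinates differ from [x] and [y] by less than 1. *)
  set (M := Rabs x + Rabs y + 1).
  destruct (uniform_continuity_2d a (-M) M (-M) M) with (eps := pos_div_2 eps) as [d hd].
  { intros; apply smooth_cont, cfun_smooth. }
  assert (hx := Rabs_pos x); assert (hy := Rabs_pos y).
  exists (mkposreal _ (Rmin_stable_in_posreal d (mkposreal 1 Rlt_0_1))); simpl; intros u v hu hv.
  assert (hu1 := Rlt_le_trans _ _ _ hu (Rmin_l _ _)).
  assert (hu2 := Rlt_le_trans _ _ _ hu (Rmin_r _ _)).
  assert (hv1 := Rlt_le_trans _ _ _ hv (Rmin_l _ _)).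
  assert (hv2 := Rlt_le_trans _ _ _ hv (Rmin_r _ _)).
  unfold ray_int.
  rewrite <- (RInt_minus (V := R_CompleteNormedModule)) by apply ex_RInt_ray_integrand.
  (* The integral bound is not strict; halving [eps] makes the final inequality strict. *)
  apply Rle_lt_trans with ((1 - 0) * pos_div_2 eps).
  2: { simpl; destruct eps as [e he]; simpl; lra. }
  apply abs_RInt_le_const; [lra | |].
  { apply (ex_RInt_minus (V := R_NormedModule)); apply ex_RInt_ray_integrand. }
  intros t ht.
  assert (contract : forall z, Rabs (t * z) <= Rabs z).
  { intros z; rewrite Rabs_mult, (Rabs_pos_eq t) by lra.
    assert (hz := Rabs_pos z); nra. }
  assert (box : forall z w, Rabs w <= M - 1 -> Rabs (z - w) < 1 -> - M <= t * z <= M).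
  { intros z w hw hz; apply Rabs_le_between.
    apply Rle_trans with (1 := contract z).
    replace z with ((z - w) + w) by ring.
    apply Rle_trans with (1 := Rabs_triang _ _); lra. }
  assert (self : forall w, Rabs (w - w) < 1) by (intros; rewrite Rminus_diag, Rabs_R0; lra).
  change (Rabs (t ^ n * a (t * u) (t * v) - t ^ n * a (t * x) (t * y)) <= pos_div_2 eps).
  rewrite <- Rmult_minus_distr_l, Rabs_mult.
  assert (ht1 : Rabs (t ^ n) <= 1).
  { rewrite <- RPow_abs, Rabs_pos_eq by lra; rewrite <- (pow1 n); apply pow_incr; lra. }
  assert (h : Rabs (a (t * u) (t * v) - a (t * x) (t * y)) < pos_div_2 eps).
  { apply hd.
    - apply (box x x); [unfold M; lra | auto].
    - apply (box y y); [unfold M; lra | auto].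
    - apply (box u x); [unfold M; lra | auto].
    - apply (box v y); [unfold M; lra | auto].
    - rewrite <- Rmult_minus_distr_l; apply Rle_lt_trans with (1 := contract _); exact hu1.
    - rewrite <- Rmult_minus_distr_l; apply Rle_lt_trans with (1 := contract _); exact hv1. }
  assert (h0 := Rabs_pos (a (t * u) (t * v) - a (t * x) (t * y))).
  assert (h1 := Rabs_pos (t ^ n)).
  nra.
Qed.

(** Induction on the order of differentiability, with [n] and [a] general because a partial
    derivative changes both. *)
Lemma smooth_ray_int n (a : Cinf) : smooth (ray_int n a).
Proof.
  intros m; revert n a; induction m as [|m IH]; intros n a.
  - intros x y; split; [apply ray_int_continuity_2d | exact I].
  - apply ex_diff_n_S.
    + intros; apply ray_int_continuity_2d.
    + intros; eexists; apply is_derive_ray_int_x.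
    + intros; eexists; apply is_derive_ray_int_y.
    + apply ex_diff_n_ext with (2 := IH (S n) (cdx a)).
      intros; symmetry; apply is_derive_unique, is_derive_ray_int_x.
    + apply ex_diff_n_ext with (2 := IH (S n) (cdy a)).
      intros; symmetry; apply is_derive_unique, is_derive_ray_int_y.
Qed.

Definition cray (n : nat) (a : Cinf) : Cinf := mkCinf _ (smooth_ray_int n a).

Lemma cdx_cray n a : cdx (cray n a) = cray (S n) (cdx a).
Proof. apply Cinf_ext; intros; apply is_derive_unique, is_derive_ray_int_x. Qed.

Lemma cdy_cray n a : cdy (cray n a) = cray (S n) (cdy a).
Proof. apply Cinf_ext; intros; apply is_derive_unique, is_derive_ray_int_y. Qed.

(** Integrate the derivative of [t ^ S n * a (t * x) (t * y)] over [[0, 1]]: the boundary term at 0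
    vanishes because the exponent is positive. *)
Lemma euler_cray n a : (euler (cray n a) + ccst (INR (S n)) * cray n a)%Ci = a.
Proof.
  unfold euler; rewrite cdx_cray, cdy_cray.
  apply Cinf_ext; intros x y.
  cbn [cfun cadd cmul cx cy ccst cray]; unfold ray_int.
  assert (H : is_RInt (fun t => x * (t ^ S n * cdx a (t * x) (t * y)) +
                y * (t ^ S n * cdy a (t * x) (t * y)) +
                INR (S n) * (t ^ n * a (t * x) (t * y))) 0 1 (a x y)).
  { replace (a x y) with
      (minus (1 ^ S n * a (1 * x) (1 * y)) (0 ^ S n * a (0 * x) (0 * y)))
      by (unfold minus, plus, opp; simpl; rewrite pow1, !Rmult_1_l; ring).
    apply (is_RInt_derive (V := R_CompleteNormedModule) (fun t => t ^ S n * a (t * x) (t * y))).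
    - intros t _.
      replace (x * (t ^ S n * cdx a (t * x) (t * y)) +
               y * (t ^ S n * cdy a (t * x) (t * y)) +
               INR (S n) * (t ^ n * a (t * x) (t * y)))
        with (INR (S n) * t ^ n * a (t * x) (t * y) +
              t ^ S n * (x * cdx a (t * x) (t * y) + y * cdy a (t * x) (t * y))) by ring.
      apply (is_derive_mult (fun t => t ^ S n) (fun t => a (t * x) (t * y))).
      + apply is_derive_Reals, derivable_pt_lim_pow.
      + apply is_derive_ray.
      + intros; apply Rmult_comm.
    - intros t _; apply (continuous_plus (V := R_NormedModule));
        [apply (continuous_plus (V := R_NormedModule))|];
        apply (continuous_scal_r (V := R_NormedModule)), continuous_ray_integrand. }
  rewrite <- (is_RInt_unique _ _ _ _ H).
  assert (hx := ex_RInt_ray_integrand (S n) (cdx a) x y).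
  assert (hy := ex_RInt_ray_integrand (S n) (cdy a) x y).
  assert (h0 := ex_RInt_ray_integrand n a x y).
  symmetry; apply is_RInt_unique.
  apply (is_RInt_plus (V := R_NormedModule)); [apply (is_RInt_plus (V := R_NormedModule))|];
    apply (is_RInt_scal (V := R_NormedModule)), (RInt_correct (V := R_CompleteNormedModule));
    assumption.
Qed.

(** Here [0 ^ n] is [1] for [n = 0]. *)
Lemma euler_kernel n (a : Cinf) :
  (euler a + ccst (INR n) * a)%Ci = ccst 0 -> a = ccst (0 ^ n * a 0 0).
Proof.
  intros h; apply Cinf_ext; intros x y.
  change (ccst (0 ^ n * a 0 0) x y) with (0 ^ n * a 0 0).
  assert (hder : forall t, is_derive (fun t => t ^ n * a (t * x) (t * y)) t
    (INR n * t ^ pred n * a (t * x) (t * y) +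
     t ^ n * (x * cdx a (t * x) (t * y) + y * cdy a (t * x) (t * y)))).
  { intros t; apply (is_derive_mult (fun t => t ^ n) (fun t => a (t * x) (t * y))).
    - apply is_derive_Reals, derivable_pt_lim_pow.
    - apply is_derive_ray.
    - intros; apply Rmult_comm. }
  (* The function [t ^ n * a (t * x) (t * y)] has zero derivative on the open interval, so its
     values at 0 and 1 agree. *)
  destruct (MVT_gen (fun t => t ^ n * a (t * x) (t * y)) 0 1 (fun _ => 0)) as [c [_ hc]].
  - rewrite Rmin_left, Rmax_right by lra; intros t ht.
    match type of (hder t) with is_derive _ _ ?d => replace 0 with d; [apply hder|] end.
    (* Multiplied by [t > 0], the derivative becomes [t ^ n] times the value of [euler a + n a] at
       [(t x, t y)]. *)
    apply (Rmult_eq_reg_l t); [|lra].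
    assert (e := f_equal (fun b : Cinf => b (t * x) (t * y)) h).
    cbn [euler cfun cadd cmul cx cy ccst] in e.
    transitivity (t ^ n * 0); [rewrite <- e | ring].
    destruct n as [|n]; [simpl | cbn [pred]; rewrite <- tech_pow_Rmult]; simpl; ring.
  - intros t _; apply continuity_pt_filterlim, continuous_ray_integrand.
  - cbv beta in hc; rewrite pow1, !Rmult_0_l, !Rmult_1_l in hc; lra.
Qed.

(** * Hadamard's lemma, the image of the Euler operator, and Koszul exactness *)

Lemma euler_eq_0 (a : Cinf) : euler a = ccst 0 -> a = ccst (a 0 0).
Proof.
  intros h; rewrite (euler_kernel 0 a) at 1.
  - f_equal; simpl; ring.
  - simpl INR; rewrite h; ring.
Qed.

(** Since [euler (cx * b) = cx * (euler b + b)] and [cray 0] inverts [euler + 1], the left side has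
    the same image under [euler] as [a]. Their difference is then constant, and is evaluated at the
    origin. *)
Lemma hadamard (a : Cinf) :
  (cx * cray 0 (cdx a) + cy * cray 0 (cdy a))%Ci = (a - ccst (a 0%R 0%R))%Ci.
Proof.
  set (s := (cx * cray 0 (cdx a) + cy * cray 0 (cdy a))%Ci).
  assert (hs : euler s = euler a).
  { assert (hx := euler_cray 0 (cdx a)); assert (hy := euler_cray 0 (cdy a)).
    simpl INR in hx, hy; unfold s.
    transitivity (cx * (euler (cray 0 (cdx a)) + 1 * cray 0 (cdx a)) +
                  cy * (euler (cray 0 (cdy a)) + 1 * cray 0 (cdy a)))%Ci.
    - unfold euler; cder; ring.
    - rewrite hx, hy; reflexivity. }
  assert (h : (a - s)%Ci = ccst ((a - s)%Ci 0 0)).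
  { apply euler_eq_0; transitivity (euler a - euler s)%Ci.
    - unfold euler; cder; ring.
    - rewrite hs; ring. }
  replace ((a - s)%Ci 0 0) with (a 0 0) in h by (simpl; ring).
  rewrite <- h; ring.
Qed.

(** Write [v = x a + y b] by Hadamard and apply [cray 0] once more, to [a] and [b]. *)
Lemma euler_surj (v : Cinf) : v 0 0 = 0 -> exists u, euler u = v.
Proof.
  intros hv; assert (h := hadamard v); rewrite hv in h.
  set (a := cray 0 (cdx v)) in h; set (b := cray 0 (cdy v)) in h.
  exists (cx * cray 0 a + cy * cray 0 b)%Ci.
  assert (ha := euler_cray 0 a); assert (hb := euler_cray 0 b); simpl INR in ha, hb.
  transitivity (cx * (euler (cray 0 a) + 1 * cray 0 a) +
                cy * (euler (cray 0 b) + 1 * cray 0 b))%Ci.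
  - unfold euler; cder; ring.
  - rewrite ha, hb, h; ring.
Qed.

(** Differentiating the relation gives [(D + 1) F = - y c] and [(D + 1) G = x c] with
    [c = G_x - F_y]. If [(D + 2) q = c], then [- y q] and [x q] solve the same equations, and
    [D + 1] is injective. No division by a coordinate occurs, so [q] is smooth at the origin too. *)
Lemma koszul_exact (F G : Cinf) :
  (cx * F + cy * G)%Ci = ccst 0 -> exists q, F = (- (cy * q))%Ci /\ G = (cx * q)%Ci.
Proof.
  intros h.
  assert (hx : (F + cx * cdx F + cy * cdx G)%Ci = ccst 0)
    by (rewrite <- (cdx_cst 0), <- h; cder; ring).
  assert (hy : (G + cx * cdy F + cy * cdy G)%Ci = ccst 0)
    by (rewrite <- (cdy_cst 0), <- h; cder; ring).
  set (c := (cdx G - cdy F)%Ci).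
  assert (hq := euler_cray 1 c); set (q := cray 1 c) in *.
  replace (ccst (INR 2)) with (1 + 1)%Ci in hq
    by (apply Cinf_ext; intros; simpl; ring).
  exists q.
  assert (hF : (F + cy * q)%Ci = ccst 0).
  { rewrite (euler_kernel 1 (F + cy * q)%Ci).
    - f_equal; ring.
    - transitivity ((F + cx * cdx F + cy * cdx G) +
                    cy * ((euler q + (1 + 1) * q) - c))%Ci.
      + unfold euler, c; simpl INR; cder; ring.
      + rewrite hx, hq; ring. }
  assert (hG : (G - cx * q)%Ci = ccst 0).
  { rewrite (euler_kernel 1 (G - cx * q)%Ci).
    - f_equal; ring.
    - transitivity ((G + cx * cdy F + cy * cdy G) -
                    cx * ((euler q + (1 + 1) * q) - c))%Ci.
      + unfold euler, c; simpl INR; cder; ring.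
      + rewrite hy, hq; ring. }
  split.
  - transitivity ((F + cy * q) - cy * q)%Ci; [ring | rewrite hF; ring].
  - transitivity ((G - cx * q) + cx * q)%Ci; [ring | rewrite hG; ring].
Qed.

Lemma r2_mul_eq_0 (e : Cinf) : (r2 * e)%Ci = ccst 0 -> e = ccst 0.
Proof.
  intros h; apply Cinf_ext; intros x y; simpl.
  destruct (Req_dec (x * x + y * y) 0) as [h0|h0].
  - assert (x = 0) by nra; assert (y = 0) by nra; subst x y.
    (* At the origin, the second derivative of [r^2 e] is [2 e]. *)
    assert (hD : cdx (cdx (r2 * e)) = (e + e + r2 * cdx (cdx e) +
                   (cx * cdx e + cx * cdx e + cx * cdx e + cx * cdx e))%Ci)
      by (unfold r2; cder; ring).
    rewrite h, !cdx_cst in hD.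
    apply (f_equal (fun b : Cinf => b 0 0)) in hD; simpl in hD; lra.
  - apply (f_equal (fun b : Cinf => b x y)) in h; simpl in h.
    apply Rmult_integral in h; tauto.
Qed.

(** * The differential in coordinates *)

(** [ring] over [Cinf] treats [ccst (1 / 2)] as an atom, so this relation is supplied by hand. *)
Lemma half_add_half (a : Cinf) : (ccst (1 / 2) * a + ccst (1 / 2) * a)%Ci = a.
Proof. apply Cinf_ext; intros; simpl; field. Qed.

Lemma Pi_r2E : bivector Pi_r2 = Mvf 0 0 0 r2.
Proof. apply mvf_ext; simpl; ring. Qed.

Lemma dP_fn f : dP Pi_r2 (Mvf f 0 0 0) = Mvf 0 (r2 * cdy f) (- (r2 * cdx f)) 0.
Proof. unfold dP; rewrite Pi_r2E; apply schouten20. Qed.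

Lemma dP_vect f g : dP Pi_r2 (Mvf 0 f g 0) =
  Mvf 0 0 0 (r2 * (cdx f + cdy g) - ((1 + 1) * (cx * f + cy * g))).
Proof.
  unfold dP; rewrite Pi_r2E, schouten21; apply mvf_ext; simpl; auto.
  unfold r2; cder; ring.
Qed.

Lemma dP_bivect f : dP Pi_r2 (Mvf 0 0 0 f) = zero.
Proof. unfold dP; rewrite Pi_r2E; apply schouten22. Qed.

Lemma dthetaE : dtheta = Mvf 0 (- cy) cx 0.
Proof. apply mvf_ext; simpl; ring. Qed.

Lemma DrE : Dr = Mvf 0 cx cy 0.
Proof. apply mvf_ext; simpl; ring. Qed.

Lemma VolE : Vol = Mvf 0 0 0 1.
Proof. apply mvf_ext; simpl; ring. Qed.

Lemma homog0_inv a : homog 0 a -> a = Mvf (mv0 a) 0 0 0.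
Proof.
  intros (_ & h1 & h2); destruct h1 as [hx hy]; [lia|].
  apply mvf_ext; simpl; auto; apply h2; lia.
Qed.

Lemma homog1_inv a : homog 1 a -> a = Mvf 0 (mvx a) (mvy a) 0.
Proof.
  intros (h0 & _ & h2); apply mvf_ext; simpl; auto; [apply h0 | apply h2]; lia.
Qed.

Lemma homog2_inv a : homog 2 a -> a = Mvf 0 0 0 (mvxy a).
Proof.
  intros (h0 & h1 & _); destruct h1 as [hx hy]; [lia|].
  apply mvf_ext; simpl; auto; apply h0; lia.
Qed.

(** * Cocycles and coboundaries in degrees 0, 1 and 2 *)

Lemma cocycle0_const f :
  dP Pi_r2 (Mvf f 0 0 0) = zero -> f = ccst (f 0 0).
Proof.
  rewrite dP_fn; intros h.
  assert (hy : cdy f = ccst 0) by (apply r2_mul_eq_0; exact (f_equal mvx h)).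
  assert (hx : cdx f = ccst 0).
  { apply r2_mul_eq_0; apply (f_equal mvy) in h; simpl in h.
    transitivity (- - (r2 * cdx f))%Ci; [ring | rewrite h; ring]. }
  apply euler_eq_0; unfold euler; rewrite hx, hy; ring.
Qed.

Lemma cocycle1_decomp f g :
  dP Pi_r2 (Mvf 0 f g 0) = zero ->
  exists (a b : R) (h : Cinf),
    f = (ccst a * - cy + ccst b * cx + r2 * cdy h)%Ci /\
    g = (ccst a * cx + ccst b * cy - r2 * cdx h)%Ci.
Proof.
  rewrite dP_vect; intros hX; apply (f_equal mvxy) in hX; simpl in hX.
  set (p := (ccst (1 / 2) * (cdx f + cdy g))%Ci).
  assert (hp : (p + p)%Ci = (cdx f + cdy g)%Ci) by apply half_add_half.
  assert (hr : (r2 * p)%Ci = (cx * f + cy * g)%Ci).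
  { transitivity (ccst (1 / 2) * (r2 * (cdx f + cdy g) - (1 + 1) * (cx * f + cy * g)) +
       (ccst (1 / 2) * (cx * f + cy * g) + ccst (1 / 2) * (cx * f + cy * g)))%Ci.
    - unfold p; ring.
    - rewrite hX, half_add_half; ring. }
  destruct (koszul_exact (f - cx * p) (g - cy * p)) as (q & hF & hG).
  { transitivity (cx * f + cy * g - r2 * p)%Ci; [unfold r2; ring | rewrite hr; ring]. }
  assert (hf : f = (cx * p - cy * q)%Ci)
    by (transitivity ((f - cx * p) + cx * p)%Ci; [ring | rewrite hF; ring]).
  assert (hg : g = (cy * p + cx * q)%Ci)
    by (transitivity ((g - cy * p) + cy * p)%Ci; [ring | rewrite hG; ring]).
  (* The divergence of [p Dr + q dtheta] is [2 p + D p + dtheta(q)], and it equals [2 p] by the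
     choice of [p]. *)
  assert (hpq : (euler p + (cx * cdy q - cy * cdx q))%Ci = ccst 0).
  { transitivity ((cdx (cx * p - cy * q) + cdy (cy * p + cx * q)) - (p + p))%Ci.
    - unfold euler; cder; ring.
    - rewrite hp, <- hf, <- hg; ring. }
  set (p0 := p 0 0); set (q0 := q 0 0).
  destruct (euler_surj (ccst q0 - q)%Ci) as [h hh]; [unfold q0; simpl; ring|].
  set (T := (cx * cdy h - cy * cdx h)%Ci).
  assert (hT : T = (p - ccst p0)%Ci).
  (* Rotation commutes with [D], so [D T = dtheta(D h) = - dtheta(q) = D p]; both [T] and [p - p0]
     vanish at the origin. *)
  { assert (e : (T - (p - ccst p0))%Ci = ccst ((T - (p - ccst p0))%Ci 0 0)).
    { apply euler_eq_0.
      transitivity (cx * cdy (euler h) - cy * cdx (euler h) - euler p)%Ci.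
      - unfold T, euler; cder; ring.
      - rewrite hh; transitivity (- (euler p + (cx * cdy q - cy * cdx q)))%Ci.
        + cder; ring.
        + rewrite hpq; ring. }
    replace ((T - (p - ccst p0))%Ci 0 0) with 0 in e by (unfold p0; simpl; ring).
    transitivity ((T - (p - ccst p0)) + (p - ccst p0))%Ci; [ring | rewrite e; ring]. }
  exists q0, p0, h; split.
  (* With [D h = q0 - q] and [T = p - p0], the remainder is [y D h + x T = r^2 h_y]; in the other
     component it is [y T - x D h = - r^2 h_x]. *)
  - transitivity (cy * (ccst q0 - q) + cx * (p - ccst p0) + ccst q0 * - cy + ccst p0 * cx)%Ci.
    + rewrite hf at 1; ring.
    + rewrite <- hh, <- hT; unfold T, euler, r2; ring.
  - transitivity (cy * (p - ccst p0) - cx * (ccst q0 - q) + ccst q0 * cx + ccst p0 * cy)%Ci.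
    + rewrite hg at 1; ring.
    + rewrite <- hh, <- hT; unfold T, euler, r2; ring.
Qed.

(** A Hamiltonian vector field is divisible by [r2], so its linear part at the origin vanishes, and
    the linear part [- a y + b x] of the first component alone determines [a] and [b]. *)
Lemma hamiltonian_indep (a b : R) h :
  dP Pi_r2 (Mvf h 0 0 0) = Mvf 0 (ccst a * - cy + ccst b * cx) (ccst a * cx + ccst b * cy) 0 ->
  a = 0 /\ b = 0.
Proof.
  rewrite dP_fn; intros e; apply (f_equal mvx) in e; simpl in e.
  assert (ex : cdx (r2 * cdy h) = (cx * cdy h + cx * cdy h + r2 * cdx (cdy h))%Ci)
    by (unfold r2; cder; ring).
  assert (ey : cdy (r2 * cdy h) = (cy * cdy h + cy * cdy h + r2 * cdy (cdy h))%Ci)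
    by (unfold r2; cder; ring).
  replace (cdx (r2 * cdy h)) with (ccst b) in ex by (rewrite e; cder; ring).
  replace (cdy (r2 * cdy h)) with (- ccst a)%Ci in ey by (rewrite e; cder; ring).
  apply (f_equal (fun u : Cinf => u 0 0)) in ex; apply (f_equal (fun u : Cinf => u 0 0)) in ey.
  simpl in ex, ey; lra.
Qed.

Lemma bivect_decomp (k : Cinf) :
  exists (a b : R) (f g : Cinf), Mvf 0 0 0 (k - (ccst a + ccst b * r2)) = dP Pi_r2 (Mvf 0 f g 0).
Proof.
  assert (hk := hadamard k).
  set (u := cray 0 (cdx k)) in hk; set (v := cray 0 (cdy k)) in hk.
  set (w := (ccst (1 / 2) * (cdx u + cdy v))%Ci).
  destruct (euler_surj (w - ccst (w 0%R 0%R))%Ci) as [h hh]; [simpl; ring|].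
  exists (k 0 0), (w 0 0).
  (* The field is [h Dr - (u d/dx + v d/dy) / 2], combining both corrections. *)
  exists (cx * h - ccst (1 / 2) * u)%Ci, (cy * h - ccst (1 / 2) * v)%Ci.
  rewrite dP_vect; apply mvf_ext; cbn [mv0 mvx mvy mvxy]; auto.
  transitivity (r2 * (euler h - w) +
    ((ccst (1 / 2) * (cx * u + cy * v)) + (ccst (1 / 2) * (cx * u + cy * v))))%Ci.
  - rewrite hh, half_add_half, hk; ring.
  - unfold r2, w, euler; cder; ring.
Qed.

(** The coefficient of a coboundary vanishes at the origin together with its Laplacian there,
    whereas [a + b r^2] has value [a] and Laplacian [4 b]. *)
Lemma bivect_indep (a b : R) f g :
  dP Pi_r2 (Mvf 0 f g 0) = Mvf 0 0 0 (ccst a + ccst b * r2) -> a = 0 /\ b = 0.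
Proof.
  rewrite dP_vect; intros e; apply (f_equal mvxy) in e; simpl in e.
  remember (cdx f + cdy g)%Ci as w eqn:hw in e.
  assert (e0 := f_equal (fun u : Cinf => u 0 0) e); simpl in e0.
  split; [lra|].
  (* The Laplacian of [r^2 w - 2 (x f + y g)] at the origin is [4 w - 4 (f_x + g_y) = 0]. *)
  assert (el := f_equal (fun u => (cdx (cdx u) + cdy (cdy u))%Ci) e); cbv beta in el.
  assert (hl : (cdx (cdx (r2 * w - (1 + 1) * (cx * f + cy * g))) +
                cdy (cdy (r2 * w - (1 + 1) * (cx * f + cy * g))))%Ci =
    (r2 * (cdx (cdx w) + cdy (cdy w)) + cx * ((1 + 1 + 1 + 1) * cdx w) +
     cy * ((1 + 1 + 1 + 1) * cdy w) + (1 + 1 + 1 + 1) * (w - (cdx f + cdy g)) -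
     (1 + 1) * (cx * (cdx (cdx f) + cdy (cdy f)) + cy * (cdx (cdx g) + cdy (cdy g))))%Ci)
    by (unfold r2; cder; ring).
  rewrite hl in el.
  assert (hr : (cdx (cdx (ccst a + ccst b * r2)) + cdy (cdy (ccst a + ccst b * r2)))%Ci =
    ((1 + 1 + 1 + 1) * ccst b)%Ci) by (unfold r2; cder; ring).
  rewrite hr in el.
  apply (f_equal (fun u : Cinf => u 0 0)) in el; rewrite hw in el; simpl in el; lra.
Qed.

(** * Bases of subquotients from representatives *)

Lemma minus_zero_V (V : ModuleSpace R_Ring) (v : V) : minus v (@zero V) = v.
Proof. exact (@minus_zero_r V v). Qed.

(** Reduces a basis statement about cosets to two statements about representatives. *)
Lemma is_basis_cls1 (V : ModuleSpace R_Ring) (Z B : subspace V) (e : V) (he : Z e) :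
  (forall a : R, B (scal a e) -> a = 0) ->
  (forall z, Z z -> exists a : R, B (minus z (scal a e))) ->
  is_basis (V := subquot_ModuleSpace V Z B) [cls e he].
Proof.
  intros hi hs; split.
  - intros [|a [|]] hl h; try discriminate hl; simpl in h.
    rewrite plus_zero_r in h.
    (* Exposes the operations behind the canonical structures, so that the rules for [cls] can
       rewrite. *)
    change (sq_scal a (@cls V Z B e he) = cls zero (mem_zero Z)) in h.
    rewrite sq_scal_cls in h; apply cls_eq in h; rewrite minus_zero_V in h.
    constructor; auto.
  - intros v; destruct (subquot_ind' _ _ _ v) as (z & hz & ->).
    destruct (hs z hz) as [a ha]; exists [a]; auto; simpl.
    rewrite plus_zero_r.
    change (cls z hz = sq_scal a (@cls V Z B e he)).
    rewrite sq_scal_cls; now apply cls_eq.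
Qed.

Lemma is_basis_cls2 (V : ModuleSpace R_Ring) (Z B : subspace V)
    (e e' : V) (he : Z e) (he' : Z e') :
  (forall a b : R, B (plus (scal a e) (scal b e')) -> a = 0 /\ b = 0) ->
  (forall z, Z z -> exists a b : R, B (minus z (plus (scal a e) (scal b e')))) ->
  is_basis (V := subquot_ModuleSpace V Z B) [cls e he; cls e' he'].
Proof.
  intros hi hs; split.
  - intros [|a [|b [|]]] hl h; try discriminate hl; simpl in h.
    rewrite plus_zero_r in h.
    change (sq_plus (sq_scal a (@cls V Z B e he)) (sq_scal b (@cls V Z B e' he')) =
            cls zero (mem_zero Z)) in h.
    rewrite !sq_scal_cls, sq_plus_cls in h; apply cls_eq in h; rewrite minus_zero_V in h.
    destruct (hi a b h); repeat constructor; auto.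
  - intros v; destruct (subquot_ind' _ _ _ v) as (z & hz & ->).
    destruct (hs z hz) as (a & b & hab); exists [a; b]; auto; simpl.
    rewrite plus_zero_r.
    change (cls z hz = sq_plus (sq_scal a (@cls V Z B e he)) (sq_scal b (@cls V Z B e' he'))).
    rewrite !sq_scal_cls, sq_plus_cls; now apply cls_eq.
Qed.
Theorem theorem5p1 :
  ((dtheta ∧ Dr)%mv = opp (fn r2 ∧ Vol)%mv /\
   opp (fn r2 ∧ Vol)%mv = opp (bivector Pi_r2)) /\
  (exists h1 : cocycles Pi_r2 0 (fn 1),
     is_basis [class h1]) /\
  (exists (htheta : cocycles Pi_r2 1 dtheta) (hr : cocycles Pi_r2 1 Dr),
     is_basis [class htheta; class hr]) /\
  (exists (hvol : cocycles Pi_r2 2 Vol) (hpi : cocycles Pi_r2 2 Pi_r2),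
     is_basis [class hvol; class hpi]).
Proof.
  split; [split|split; [|split]].
  - apply mvf_ext; simpl; unfold r2; ring.
  - reflexivity.
  - assert (h1 : cocycles Pi_r2 0 (fn 1)).
    { split; [apply homog0|]; unfold fn; rewrite dP_fn; cder.
      apply mvf_ext; simpl; ring. }
    exists h1; apply is_basis_cls1.
    + intros a [b hb e].
      (* A primitive would have degree -1, hence is zero. *)
      rewrite (homog_out _ _ hb), dP_zero in e by lia.
      apply (f_equal (fun m => mv0 m 0 0)) in e; simpl in e; lra.
    + intros z [hz ez]; rewrite (homog0_inv z hz) in ez |- *.
      exists (mv0 z 0 0); exists zero; [apply homog_zero|].
      rewrite dP_zero, (cocycle0_const _ ez) at 1.
      apply mvf_ext; simpl; ring.
  - assert (ht : cocycles Pi_r2 1 dtheta).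
    { rewrite dthetaE; split; [apply homog1|]; rewrite dP_vect.
      apply mvf_ext; simpl; auto; cder; ring. }
    assert (hr : cocycles Pi_r2 1 Dr).
    { rewrite DrE; split; [apply homog1|]; rewrite dP_vect.
      apply mvf_ext; simpl; auto; unfold r2; cder; ring. }
    exists ht, hr; apply is_basis_cls2.
    + intros a b [c hc e]; apply homog0_inv in hc; rewrite hc in e.
      apply (hamiltonian_indep a b (mv0 c)); rewrite <- e, dthetaE, DrE.
      apply mvf_ext; simpl; ring.
    + intros z [hz ez]; rewrite (homog1_inv z hz) in ez |- *.
      destruct (cocycle1_decomp _ _ ez) as (a & b & h & ef & eg).
      exists a, b; exists (Mvf h 0 0 0); [apply homog0|].
      rewrite dP_fn, ef, eg, dthetaE, DrE.
      apply mvf_ext; simpl; ring.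
  - assert (hv : cocycles Pi_r2 2 Vol)
      by (rewrite VolE; split; [apply homog2 | apply dP_bivect]).
    assert (hp : cocycles Pi_r2 2 Pi_r2)
      by (rewrite Pi_r2E; split; [apply homog2 | apply dP_bivect]).
    exists hv, hp; apply is_basis_cls2.
    + intros a b [c hc e]; apply homog1_inv in hc; rewrite hc in e.
      apply (bivect_indep a b (mvx c) (mvy c)); rewrite <- e, VolE, Pi_r2E.
      apply mvf_ext; simpl; ring.
    + intros z [hz _]; rewrite (homog2_inv z hz).
      destruct (bivect_decomp (mvxy z)) as (a & b & f & g & e).
      exists a, b; exists (Mvf 0 f g 0); [apply homog1|].
      rewrite <- e, VolE, Pi_r2E.
      apply mvf_ext; simpl; ring.
Qed.
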